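(* Let $L_i:\mathbb{R}^{n_{i-1}}\to\mathbb{R}^{n_i}$, $i=1,\ldots,N$, be affine linear functions with $n_0=n$, let $r_i$ ($i=1,\ldots,N-1$) be the entrywise ReLu functions on $\mathbb{R}^{n_i}$, and let $\sigma:\mathbb{R}^{n_N}\to\{1,\ldots,n_N\}$ be the index-max function. Then the function \[\sigma \circ L_{N} \circ r_{N-1} \circ L_{N-1} \circ \cdots \circ r_1 \circ L_1:\ \mathbb{R}^n\to\{1,\ldots,n_N\}\] (a feed-forward network with ReLu activation functions at the hidden layers and index-max at the last layer) is a linear logical function.
   Context: The ReLu function is $x\mapsto\max(x,0)$. The index-max function $\sigma$ sends a vector to the index of its maximal entry (with a fixed tie-breaking convention, e.g. the smallest such index). Linear logical functions. For an affine linear function $l=(l_1,\ldots,l_k)$ on $\mathbb{R}^n$, the chambers of $l$ are the regions into which $\mathbb{R}^n$ is subdivided by the hyperplanes $\{l_i=0\}$; they are defined to contain some of their boundary strata in such a way that they are disjoint and their union is $\mathbb{R}^n$ (concretely: the nonempty sets obtained by imposing, for each $i$, either $l_i\ge 0$ or $l_i<0$). Let $D\subset\mathbb{R}^n$ and let $T$ be a finite set. A linear logical graph $(G,L)$ consists of a finite directed graph $G$ (parallel arrows allowed) with no oriented cycle, with exactly one source vertex (vertex with no incoming arrow) and exactly $|T|$ target vertices (vertices with no outgoing arrow), identified with the elements of $T$, together with a collection $L=\{l_v\}$ of affine linear functions on $\mathbb{R}^n$, one for each vertex $v$ having more than one outgoing arrow, such that the chambers of $l_v$ are in one-to-one correspondence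 with the outgoing arrows of $v$. It determines a function $f_{G,L}: D\to T$: given $x\in D$, start at the source vertex; at a vertex with exactly one outgoing arrow follow that arrow; at a vertex $v$ with more than one outgoing arrow follow the arrow corresponding to the chamber of $l_v$ containing $x$; this stops at a target vertex, and $f_{G,L}(x)\in T$ is the element associated to it. A function $D\to T$ is a linear logical function if it equals $f_{G,L}$ for some linear logical graph $(G,L)$. *)

(* Defs.v *)
From HB Require Import structures.
From mathcomp Require Import all_boot all_order all_algebra.
From mathcomp Require Import boolp classical_sets functions reals.

Set Implicit Arguments.
Unset Strict Implicit.
Unset Printing Implicit Defensive.

Import Order.TTheory GRing.Theory Num.Theory.
Local Open Scope ring_scope.
Local Open Scope classical_set_scope.

Definition affine (R : realType) (n m : nat) (f : 'cV[R]_n -> 'cV[R]_m) : Prop :=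
  exists (A : 'M[R]_(m, n)) (b : 'cV[R]_m), forall x, f x = A *m x + b.

(* [b i] records whether [l_i >= 0] ([true]) or [l_i < 0] ([false]) is imposed. *)
Definition sign_region (R : realType) (n k : nat)
    (l : 'cV[R]_n -> 'cV[R]_k) (b : 'I_k -> bool) : set 'cV[R]_n :=
  [set x | forall i, if b i then 0 <= l x i 0 else l x i 0 < 0].

Definition chambers (R : realType) (n k : nat)
    (l : 'cV[R]_n -> 'cV[R]_k) : set (set 'cV[R]_n) :=
  [set C | C !=set0 /\ exists b, C = sign_region l b].

Record digraph := Digraph {
  vertex : finType;
  arrow : finType;
  tail_of : arrow -> vertex;
  head_of : arrow -> vertex
}.

Definition outdeg (G : digraph) (v : vertex G) : nat :=
  #|[pred a : arrow G | tail_of a == v]|.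

Definition adj (G : digraph) : rel (vertex G) :=
  fun u v => [exists a : arrow G, (tail_of a == u) && (head_of a == v)].

Record ll_graph (R : realType) (n : nat) (T : finType) := LLGraph {
  dgraph :> digraph;
  acyclic : forall c : seq (vertex dgraph), path.cycle (@adj dgraph) c -> c = [::];
  source : vertex dgraph;
  source_unique : forall v,
    (forall a : arrow dgraph, head_of a <> v) <-> v = source;
  (* identification of [T] with the set of vertices without outgoing arrow *)
  target : T -> vertex dgraph;
  target_bij : set_bij [set: T] [set v | outdeg v = 0%N] target;
  (* number of components of [l_v], then [l_v] itself and the correspondence
     between arrows and chambers; all unconstrained where [outdeg v <= 1],
     and never used there *)
  ncomp : vertex dgraph -> nat;
  ell : forall v, 'cV[R]_n -> 'cV[R]_(ncomp v);
  ell_affine : forall v, (1 < outdeg v)%N -> affine (ell v);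
  chamber : arrow dgraph -> set 'cV[R]_n;
  chamber_bij : forall v, (1 < outdeg v)%N ->
    set_bij [set a | tail_of a = v] (chambers (ell v)) chamber
}.

Definition followed (R : realType) (n : nat) (T : finType)
    (G : ll_graph R n T) (x : 'cV[R]_n) (a : arrow G) : Prop :=
  (1 < outdeg (tail_of a))%N -> chamber a x.

(* [stops_at x v w]: the walk directed by [x] from [v] stops at [w]. *)
Inductive stops_at (R : realType) (n : nat) (T : finType)
    (G : ll_graph R n T) (x : 'cV[R]_n) : vertex G -> vertex G -> Prop :=
| StopsHere v : outdeg v = 0%N -> stops_at x v v
| StopsLater a w : followed x a -> stops_at x (head_of a) w ->
    stops_at x (tail_of a) w.

Lemma followed_exists (R : realType) (n : nat) (T : finType)
    (G : ll_graph R n T) (x : 'cV[R]_n) (v : vertex G) :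
  outdeg v <> 0%N -> exists2 a : arrow G, tail_of a = v & followed x a.
Proof.
move=> v0; have [v1|v1] := ltnP 1 (outdeg v).
  have [_ _ sur] := chamber_bij v1.
  pose b i := 0 <= ell v x i 0.
  have xb : sign_region (ell v) b x.
    by move=> i; rewrite /b; case: (leP 0 (ell v x i 0)).
  have [|a av ab] := sur (sign_region (ell v) b).
    by split; [exists x | exists b].
  by exists a => // _; rewrite ab.
have /card_gt0P[a /eqP av] : (0 < #|[pred a : arrow G | tail_of a == v]|)%N.
  by rewrite lt0n; apply/eqP.
by exists a => //; rewrite /followed av ltnNge v1.
Qed.

Lemma followed_unique (R : realType) (n : nat) (T : finType)
    (G : ll_graph R n T) (x : 'cV[R]_n) (a a' : arrow G) :
  tail_of a = tail_of a' -> followed x a -> followed x a' -> a = a'.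
Proof.
move=> e; rewrite /followed -e.
have [v1 /(_ isT) xa /(_ isT) xa'|v1 _ _] := ltnP 1 (outdeg (tail_of a)).
  have [fn inj _] := chamber_bij v1.
  apply: inj; rewrite ?inE //=.
  have [_ [b eb]] := fn a erefl; have [_ [b' eb']] := fn a' (esym e).
  move: xa xa'; rewrite eb eb' => xb xb'.
  congr sign_region; apply/funext => i.
  move: (xb i) (xb' i); case: (b i); case: (b' i) => //.
    by move=> h /(le_lt_trans h); rewrite ltxx.
  by move=> h /le_lt_trans/(_ h); rewrite ltxx.
by move/card_le1_eqP: v1; apply; rewrite inE /= ?e.
Qed.

Lemma stops_at_exists (R : realType) (n : nat) (T : finType)
    (G : ll_graph R n T) (x : 'cV[R]_n) (v : vertex G) :
  exists2 w, stops_at x v w & outdeg w = 0%N.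
Proof.
have [k] := ubnP #|connect (@adj G) v|.
elim: k v => // k IH v vk.
have [v0|v0] := eqVneq (outdeg v) 0%N.
  by exists v => //; apply: StopsHere.
have [a av fa] := followed_exists x (elimN eqP v0).
have vh : adj v (head_of a) by apply/existsP; exists a; rewrite av !eqxx.
have [|w hw w0] := IH (head_of a); last first.
  by exists w => //; rewrite -av; apply: StopsLater.
rewrite -ltnS; apply: leq_trans vk; rewrite ltnS; apply: proper_card.
apply/properP; split.
  by apply/fintype.subsetP => u; apply: connect_trans; exact: connect1.
exists v; first exact: connect0.
apply/negP => /connectP[p hp e].
suff /acyclic : path.cycle (@adj G) (head_of a :: p) by [].
by rewrite /= rcons_path hp -e.
Qed.

Lemma stops_at_unique (R : realType) (n : nat) (T : finType)
    (G : ll_graph R n T) (x : 'cV[R]_n) (v w w' : vertex G) :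
  stops_at x v w -> stops_at x v w' -> w = w'.
Proof.
have tail_pos (a : arrow G) : outdeg (tail_of a) <> 0%N.
  by move/eqP; rewrite -leqn0 leqNgt => /negP[]; apply/card_gt0P; exists a; rewrite inE.
move=> h; elim: h w' => {v w} [v v0|a w fa _ IH] w' h.
  by case: h v0 => // a u _ _ /tail_pos.
move e: (tail_of a) h => v h; case: h e => [u u0 e|a' u fa' h e].
  by case: (tail_pos a); rewrite e.
by apply: IH; rewrite (followed_unique e fa fa').
Qed.

Lemma ll_fun_exists (R : realType) (n : nat) (T : finType)
    (G : ll_graph R n T) (x : 'cV[R]_n) :
  exists t, stops_at x (source G) (target G t).
Proof.
have [w hw w0] := stops_at_exists x (source G).
by have [_ _ /(_ w w0)[t _ tw]] := target_bij G; exists t; rewrite tw.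
Qed.

Definition ll_fun (R : realType) (n : nat) (T : finType)
    (G : ll_graph R n T) (x : 'cV[R]_n) : T :=
  projT1 (cid (ll_fun_exists G x)).

Lemma ll_funP (R : realType) (n : nat) (T : finType)
    (G : ll_graph R n T) (x : 'cV[R]_n) (t : T) :
  ll_fun G x = t <-> stops_at x (source G) (target G t).
Proof.
rewrite /ll_fun; case: cid => t' h' /=; split=> [<-//|h].
have [_ inj _] := target_bij G.
by apply: inj; rewrite ?inE //; apply: stops_at_unique h' h.
Qed.

(* A function [D -> T] is given by the restriction to [D] of [f]. *)
Definition linear_logical (R : realType) (n : nat) (T : finType)
    (D : set 'cV[R]_n) (f : 'cV[R]_n -> T) : Prop :=
  exists G : ll_graph R n T, {in D, f =1 ll_fun G}.

Definition relu (R : realType) (m : nat) (v : 'cV[R]_m) : 'cV[R]_m :=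
  map_mx (fun a => Num.max a 0) v.

(* A fixed tie-breaking convention selects an element of every nonempty set
   of indices, for instance the smallest one. *)
Definition tie_breaking (m : nat) (c : {set 'I_m} -> 'I_m) : Prop :=
  forall S : {set 'I_m}, S != finset.set0 -> c S \in S.

Definition index_max (R : realType) (m : nat) (c : {set 'I_m} -> 'I_m)
    (v : 'cV[R]_m) : 'I_m :=
  c (finset (fun i => [forall j, v j 0 <= v i 0])).

(* [hidden L k] is [r_k \o L_k \o ... \o r_1 \o L_1]: [L i] stands for
   [L_(i+1)], since indices start at 0. *)
Fixpoint hidden (R : realType) (d : nat -> nat)
    (L : forall i, 'cV[R]_(d i) -> 'cV[R]_(d i.+1)) (k : nat)
    (x : 'cV[R]_(d 0%N)) : 'cV[R]_(d k) :=
  match k with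
  | 0%N => x
  | k'.+1 => relu (L k' (hidden L k' x))
  end.

(* The network with [M] hidden layers, that is [N = M.+1] affine maps. *)
Definition network (R : realType) (d : nat -> nat)
    (L : forall i, 'cV[R]_(d i) -> 'cV[R]_(d i.+1)) (M : nat)
    (c : {set 'I_(d M.+1)} -> 'I_(d M.+1)) (x : 'cV[R]_(d 0%N)) : 'I_(d M.+1) :=
  index_max c (L M (hidden L M x)).

(* Main.v *)
Require Import Defs.
From mathcomp Require Import all_boot all_order all_algebra.
From mathcomp Require Import boolp classical_sets functions reals.
Local Open Scope ring_scope.
Local Open Scope classical_set_scope.

Set Implicit Arguments.
Unset Strict Implicit.
Unset Printing Implicit Defensive.

Import Order.TTheory GRing.Theory Num.Theory.

(** A network with ReLu activations is affine on each of finitely many regions,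
    and which region contains [x] is decided by the signs of finitely many
    affine forms at [x]. So the whole network factors through the finite string
    of answers to questions of the form: is [0 <= a *m x + b]? The proof
    isolates this property, [sign_determined], and shows that it is both
    satisfied by the network and sufficient for being linear logical.

    For the network, the invariant is [piecewise_affine]: the layer output is
    [A *m x + b] where the pair [(A, b)] is itself sign-determined. Affine maps
    act on the pair. ReLu zeroes the rows of [(A, b)] whose value is negative;
    the new sign test has coefficients that depend on the answers so far, but
    there are only finitely many answer strings, so asking the test for all
    possible coefficients at once keeps the list of forms finite
    ([sign_determined_signs]). The index-max function only depends on the signs
    of the differences of the entries, which are tests of the same kind.

    Conversely, a sign-determined function is evaluated by asking its questions
    one after another. The graph is the complete binary tree of answer strings,
    with the full-length strings merged into the elements of [T] that they
    determine ([question_tree]). Two conditions on a linear logical graph need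
    care. A constant form has a single chamber, which cannot label two arrows;
    constant forms are discarded, since their answers carry no information.
    Every [t : T] must be a vertex with an incoming arrow, also when the
    function never takes the value [t]; so one nonconstant form, which exists
    because [0 < n], is asked repeatedly at the start, and the inconsistent
    answer strings, followed by no [x], are used to lead to each [t]
    ([exhaustive_questions]). *)

(** * Functions determined by the signs of affine forms *)

Section SignDetermined.
Variables (R : realType) (n : nat).
Implicit Types (x y : 'cV[R]_n) (q : 'rV[R]_n * R) (qs : seq ('rV[R]_n * R)).

(** A question is the pair [q = (a, b)] of coefficients of the affine form
    [x |-> a *m x + b]. *)
Definition form_eval q x : R := (q.1 *m x) 0 0 + q.2.

Definition answers qs x : seq bool := [seq 0 <= form_eval q x | q <- qs].

Definition sign_determined (U : Type) (f : 'cV[R]_n -> U) : Prop :=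
  exists qs, forall x y, answers qs x = answers qs y -> f x = f y.

Lemma sign_determined_cst (U : Type) (u : U) : sign_determined (fun=> u).
Proof. by exists [::]. Qed.

Lemma sign_determined_comp (U V : Type) (h : U -> V) (f : 'cV[R]_n -> U) :
  sign_determined f -> sign_determined (h \o f).
Proof. by case=> qs fqs; exists qs => x y /fqs /= ->. Qed.

Lemma sign_determined_pair (U V : Type) (f : 'cV[R]_n -> U)
    (g : 'cV[R]_n -> V) :
  sign_determined f -> sign_determined g ->
  sign_determined (fun x => (f x, g x)).
Proof.
move=> [qs fqs] [rs grs]; exists (qs ++ rs) => x y.
rewrite /answers !map_cat => /eqP.
by rewrite eqseq_cat ?size_map // => /andP[/eqP/fqs-> /eqP/grs->].
Qed.

(** Questions may be chosen in terms of the answers to earlier ones: as [f]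
    takes only finitely many values, one per answer string, the adaptive
    questions [Q (f x) j] all belong to the finite list of the [Q u j] for these [u]. *)
Lemma sign_determined_signs (U : Type) (J : finType) (f : 'cV[R]_n -> U)
    (Q : U -> J -> 'rV[R]_n * R) :
  sign_determined f ->
  sign_determined (fun x => [ffun j => 0 <= form_eval (Q (f x) j) x]).
Proof.
case=> qs fqs.
(* Strings that are the answers of no [x] get the junk value [f 0]. *)
pose value (s : (size qs).-tuple bool) := f (xget 0 [set x | answers qs x = s]).
pose pattern x : (size qs).-tuple bool :=
  map_tuple (fun q => 0 <= form_eval q x) (in_tuple qs).
have valueE x : value (pattern x) = f x.
  by apply: fqs; apply: (@xgetI _ 0 [set y | answers qs y = _] x).
pose rs :=
  [seq Q (value s) j | s <- enum {: (size qs).-tuple bool}, j <- enum J].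
exists (qs ++ rs) => x y.
rewrite /answers !map_cat => /eqP.
rewrite eqseq_cat ?size_map // => /andP[/eqP/fqs fxy /eqP/eq_in_map rxy].
apply/ffunP => j; rewrite !ffunE -fxy; apply: rxy.
by apply/allpairsP; exists (pattern x, j); rewrite !mem_enum valueE.
Qed.

(** Making the local coefficients [F x] the sign-determined datum, instead of
    requiring [f] to be affine on given regions, avoids any subdivision of
    regions when layers are composed. *)
Definition piecewise_affine m (f : 'cV[R]_n -> 'cV[R]_m) : Prop :=
  exists2 F : 'cV[R]_n -> 'M[R]_(m, n) * 'cV[R]_m,
    sign_determined F & forall x, f x = (F x).1 *m x + (F x).2.

Lemma piecewise_affine_id : piecewise_affine id.
Proof.
exists (fun=> (1%:M, 0)); first exact: sign_determined_cst.
by move=> x; rewrite mul1mx addr0.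
Qed.

Lemma piecewise_affine_comp m p (f : 'cV[R]_n -> 'cV[R]_m)
    (g : 'cV[R]_m -> 'cV[R]_p) :
  affine g -> piecewise_affine f -> piecewise_affine (g \o f).
Proof.
move=> [B [b gE]] [F sF fE].
exists ((fun u => (B *m u.1, B *m u.2 + b)) \o F).
  exact: sign_determined_comp.
by move=> x /=; rewrite gE fE mulmxDr mulmxA addrA.
Qed.

Lemma piecewise_affine_relu m (f : 'cV[R]_n -> 'cV[R]_m) :
  piecewise_affine f -> piecewise_affine (@relu R m \o f).
Proof.
move=> [F sF fE].
pose Q (u : 'M[R]_(m, n) * 'cV[R]_m) i := (row i u.1, u.2 i 0).
have evalQ x i : form_eval (Q (F x) i) x = f x i 0.
  by rewrite fE /form_eval /= -row_mul !mxE.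
pose mask (p : ('M[R]_(m, n) * 'cV[R]_m) * {ffun 'I_m -> bool}) :=
  (\matrix_(i, j) (if p.2 i then p.1.1 i j else 0),
   \col_i (if p.2 i then p.1.2 i 0 else 0)).
exists (mask \o (fun x => (F x, [ffun i => 0 <= form_eval (Q (F x) i) x]))).
  apply: sign_determined_comp; apply: sign_determined_pair => //.
  exact: sign_determined_signs.
move=> x; apply/colP => i; rewrite /relu /mask /= !mxE.
under eq_bigr do rewrite mxE ffunE evalQ.
rewrite ffunE evalQ maxEle; case: (leP 0 (f x i 0)) => [fi|fi].
  rewrite fE !mxE; case: leP => //.
  by move: fi; rewrite fE !mxE => f1 f2; apply/eqP; rewrite eq_le f1 f2.
by rewrite ltW // addr0 big1 // => j _; rewrite mul0r.
Qed.

(** The set of maximizing indices is read off from the signs of the pairwise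
    differences of the entries. *)
Lemma sign_determined_index_max m (c : {set 'I_m} -> 'I_m)
    (f : 'cV[R]_n -> 'cV[R]_m) :
  piecewise_affine f -> sign_determined (index_max c \o f).
Proof.
move=> [F sF fE].
pose Q (u : 'M[R]_(m, n) * 'cV[R]_m) (ij : 'I_m * 'I_m) :=
  (row ij.1 u.1 - row ij.2 u.1, u.2 ij.1 0 - u.2 ij.2 0).
have evalQ x ij : form_eval (Q (F x) ij) x = f x ij.1 0 - f x ij.2 0.
  by rewrite fE /form_eval /= mulmxBl -!row_mul !mxE opprD addrACA.
pose choose_max (s : {ffun 'I_m * 'I_m -> bool}) :=
  c (finset (fun i => [forall j, s (i, j)])).
have -> : index_max c \o f =
    choose_max \o (fun x => [ffun ij => 0 <= form_eval (Q (F x) ij) x]).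
  apply/funext => x /=; congr c; apply/setP => i; rewrite !inE.
  by apply: eq_forallb => j; rewrite ffunE evalQ /= subr_ge0.
by apply: sign_determined_comp; apply: sign_determined_signs.
Qed.

(** This is what makes both chambers of a nonconstant form nonempty. *)
Lemma form_eval_onto q (r : R) : q.1 != 0 -> exists x, form_eval q x = r.
Proof.
case/rV0Pn => j qj; exists (((r - q.2) / q.1 0 j) *: delta_mx j 0).
rewrite /form_eval -scalemxAr -colE !mxE divfK //.
by rewrite subrK.
Qed.

(** The questions can be chosen so that every [t : T] is named by some answer
    string, whether or not [f] takes the value [t], as is required to connect
    every target of the graph to the source. The form [p] is asked [#|T| + 1]
    times; its answers at a given [x] all agree, so the strings [code t] below,
    which first answer yes and later no at the place of [t], are free to be
    assigned to [t]. *)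
Lemma exhaustive_questions (T : finType) (f : 'cV[R]_n -> T) :
  (0 < n)%N -> sign_determined f ->
  exists qs (g : seq bool -> T),
    [/\ (0 < size qs)%N, {in qs, forall q, q.1 != 0},
        forall x, g (answers qs x) = f x
      & forall t, exists2 s, size s = size qs & g s = t].
Proof.
move=> n0 [qs fqs].
pose p : 'rV[R]_n * R := (const_mx 1, 0).
have p0 : p.1 != 0.
  by apply/rV0Pn; exists (Ordinal n0); rewrite mxE oner_neq0.
pose qs' := [seq q <- qs | q.1 != 0].
pose rs := p :: [seq p | _ <- enum T] ++ qs'.
pose code t := true :: [seq t' != t | t' <- enum T] ++ nseq (size qs') true.
have code_head (s s' : seq bool) (h h' : T -> bool) :
    [seq h t | t <- enum T] ++ s = [seq h' t | t <- enum T] ++ s' -> h =1 h'.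
  move/eqP; rewrite eqseq_cat ?size_map // => /andP[/eqP/eq_in_map hh' _] t.
  by apply: hh'; rewrite mem_enum.
have code_inj : injective code.
  by move=> t t' [] /code_head/(_ t'); rewrite eqxx => /negbFE/eqP.
have code_unrealised t x : answers rs x <> code t.
  rewrite /answers /rs map_cons map_cat -map_comp /= => -[p_ge0].
  by move/code_head/(_ t) => /=; rewrite p_ge0 eqxx.
have frs x y : answers rs x = answers rs y -> f x = f y.
  move=> /eq_in_map rxy; apply: fqs; apply/eq_in_map => q qin.
  have [q0|qn0] := eqVneq q.1 0; first by rewrite /form_eval q0 !mul0mx.
  by apply: rxy; rewrite inE mem_cat mem_filter qn0 qin !orbT.
pose g s := xget (f 0) [set t | (exists2 x, answers rs x = s & f x = t)
                             \/ code t = s].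
exists rs, g; split => //.
- move=> q; rewrite inE mem_cat => /or3P[/eqP-> //|/mapP[_ _ ->] //|].
  by rewrite mem_filter => /andP[].
- move=> x; rewrite /g; case: xgetP => [_ -> [[y /frs -> <-//]|]|/(_ (f x)) []].
    by move/esym/code_unrealised.
  by left; exists x.
- move=> t; exists (code t); first by rewrite /= !size_cat size_nseq !size_map.
  rewrite /g; case: xgetP => [_ -> [[y /code_unrealised//]|/code_inj//]|].
  by move=> /(_ t)[]; right.
Qed.

End SignDetermined.

(** * The graph of a list of questions *)

Lemma cycle_increasing (V : eqType) (e : rel V) (level : V -> nat) :
  (forall u v, e u v -> (level u < level v)%N) ->
  forall s : seq V, path.cycle e s -> s = [::].
Proof.
move=> e_lt [//|v s] /(sub_path (e' := relpre level ltn) e_lt) lt_path.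
have tr : transitive (relpre level ltn) by move=> ? ? ? /=; apply: ltn_trans.
have /allP/(_ v) := order_path_min tr lt_path.
by rewrite mem_rcons inE eqxx /= ltnn => /(_ isT).
Qed.

Section QuestionTree.
Variables (R : realType) (n k : nat) (T : finType).
Variables (q : nat -> 'rV[R]_n * R) (g : seq bool -> T).
Hypothesis q_neq0 : forall i, (i <= k)%N -> (q i).1 != 0.
Hypothesis g_onto : forall t, exists2 s, size s = k.+1 & g s = t.

(** The vertices are the answer strings that are not yet complete, of length at
    most [k], and the elements of [T], where the complete strings of length
    [k.+1] are merged according to [g]. An arrow adds one answer. *)
Let V := (k.-bseq bool + T)%type.

Definition tree_next (s : seq bool) : V :=
  if insub s is Some s' then inl s' else inr (g s).

Definition tree : digraph :=
  @Digraph V (k.-bseq bool * bool)%type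
    (fun a => inl a.1) (fun a => tree_next (rcons a.1 a.2)).

Lemma tree_next_short (s : k.-bseq bool) : tree_next s = inl s.
Proof. by rewrite /tree_next valK. Qed.

Lemma tree_next_full s : size s = k.+1 -> tree_next s = inr (g s).
Proof. by move=> sk; rewrite /tree_next insubF // sk ltnn. Qed.

(** Every arrow increases the level, hence there are no cycles. *)
Definition tree_level (v : V) : nat := if v is inl s then size s else k.+1.

Lemma tree_acyclic (s : seq (vertex tree)) :
  path.cycle (@adj tree) s -> s = [::].
Proof.
move: s; apply: (@cycle_increasing _ _ tree_level) => u v.
case/existsP=> -[s b] /andP[/eqP<- /eqP<-] /=.
rewrite /tree_next; case: insubP => [s' _ s'E|_] /=.
  by rewrite [bseqval s']s'E size_rcons.
by rewrite ltnS size_bseq.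
Qed.

(** A nonempty string is reached from its prefix; [t : T] is reached from the
    string that names it, by surjectivity of [g]. *)
Lemma tree_source_unique (v : vertex tree) :
  (forall a : arrow tree, head_of a <> v) <-> v = inl [bseq].
Proof.
split=> [no_in|-> [s b] /=]; last first.
  rewrite /tree_next; case: insubP => // s' _ s'E [] s'0.
  by move: s'E; rewrite s'0 /=; case: (s : seq bool).
case: v no_in => [s|t] no_in.
  congr inl; apply: val_inj => /=.
  case/lastP sE : (val s) => [//|s' b].
  have s'k : (size s' <= k)%N.
    by have := size_bseq s; rewrite [bseqval s]sE size_rcons => /ltnW.
  by case: (no_in (Bseq s'k, b)); rewrite /= -sE tree_next_short.
have [s sk gs] := g_onto t.
case/lastP: s sk gs => // s b; rewrite size_rcons => -[sk] gs.
have sk' : (size s <= k)%N by rewrite sk.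
by case: (no_in (Bseq sk', b)); rewrite /= tree_next_full ?gs // size_rcons sk.
Qed.

Lemma tree_outdeg_leaf t : @outdeg tree (inr t) = 0%N.
Proof. exact: eq_card0. Qed.

Lemma tree_outdeg_node s : @outdeg tree (inl s) = 2%N.
Proof.
rewrite /outdeg -card_bool -(card_imset predT (f := fun b => (s, b))).
  apply: eq_card => -[s' b]; rewrite !inE /=.
  apply/eqP/imsetP => [[->]|[b' _ [-> _]] //].
  by exists b.
by move=> b b' [].
Qed.

Lemma tree_target_bij :
  set_bij [set: T] [set v | @outdeg tree v = 0%N]
    (fun t => inr t : vertex tree).
Proof.
split=> [t _|t t' _ _ []//|]; first exact: tree_outdeg_leaf.
by move=> [s|t] /=; [rewrite tree_outdeg_node|exists t].
Qed.

Definition tree_ell (v : vertex tree) (x : 'cV[R]_n) : 'cV[R]_1 :=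
  if v is inl s then (q (size s)).1 *m x + const_mx (q (size s)).2 else 0.

Lemma tree_ellE (s : k.-bseq bool) x i :
  tree_ell (inl s) x i 0 = form_eval (q (size s)) x.
Proof. by rewrite !mxE /form_eval mxE ord1. Qed.

Lemma tree_ell_affine v : affine (tree_ell v).
Proof.
case: v => [s|t]; first by exists (q (size s)).1, (const_mx (q (size s)).2).
by exists 0, 0 => x; rewrite mul0mx addr0.
Qed.

Definition tree_chamber (a : arrow tree) : set 'cV[R]_n :=
  sign_region (tree_ell (tail_of a)) (fun=> a.2).

Lemma tree_chamberP (a : arrow tree) x :
  tree_chamber a x <-> (0 <= form_eval (q (size a.1)) x) = a.2.
Proof.
case: a => s b; split=> [/(_ ord0)|bE i]; rewrite tree_ellE /=.
  by case: b => // /lt_geF.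
by case: ifP bE => _; rewrite ?leNgt //= => /negbFE.
Qed.

Lemma tree_chamber_neq0 (a : arrow tree) : tree_chamber a !=set0.
Proof.
have [x xE] := form_eval_onto (if a.2 then 1 else - 1)
  (q_neq0 (size_bseq a.1)).
exists x; apply/tree_chamberP; rewrite xE.
by case: a.2; rewrite ?ler01 // oppr_ge0 ler10.
Qed.

(** The form asked at [s] being nonconstant, its two sign regions are nonempty
    and disjoint: they are exactly two chambers, one per answer. *)
Lemma tree_chamber_bij (v : vertex tree) : (1 < outdeg v)%N ->
  set_bij [set a | tail_of a = v] (chambers (tree_ell v)) tree_chamber.
Proof.
case: v => [s|t] v1; last by rewrite tree_outdeg_leaf in v1.
split=> [a <-|a a'|].
- by split; [exact: tree_chamber_neq0|exists (fun=> a.2)].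
- rewrite !inE /= => as_ a's aa'; have [x xa] := tree_chamber_neq0 a.
  have /tree_chamberP := xa; have : tree_chamber a' x by rewrite -aa'.
  move/tree_chamberP.
  case: a a' as_ a's {aa' xa} => [s1 b1] [s2 b2] /= [->] [->].
  by move=> -> ->.
- move=> _ [_ [b ->]]; exists (s, b 0) => //.
  have bE : (fun=> b 0) = b by apply/funext => i; rewrite (ord1 i).
  by rewrite /tree_chamber /= bE.
Qed.

Definition question_tree : ll_graph R n T :=
  LLGraph tree_acyclic tree_source_unique tree_target_bij
    (fun v _ => tree_ell_affine v) tree_chamber_bij.

(** By induction on the number of answers still missing, the walk directed by
    [x] from any prefix of its answer string stops at the value of the full
    string. *)
Lemma question_tree_fun x :
  ll_fun question_tree x = g [seq 0 <= form_eval (q i) x | i <- iota 0 k.+1].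
Proof.
set ans := map _ _; apply/ll_funP => /=.
have ans_size : size ans = k.+1 by rewrite size_map size_iota.
have step (s : k.-bseq bool) w : s = take (size s) ans :> seq bool ->
    @stops_at _ _ _ question_tree x (tree_next (take (size s).+1 ans)) w ->
    @stops_at _ _ _ question_tree x (inl s) w.
  move=> sE; have sk : (size s < size ans)%N by rewrite ans_size ltnS size_bseq.
  rewrite (take_nth true) // -sE.
  apply: (@StopsLater _ _ _ question_tree x (s, nth true ans (size s))) => _.
  apply/tree_chamberP => /=.
  by rewrite (nth_map 0%N) ?size_iota ?nth_iota -?ans_size.
suff walk m : forall s : k.-bseq bool, (k - size s = m)%N ->
    s = take (size s) ans :> seq bool ->
    @stops_at _ _ _ question_tree x (inl s) (inr (g ans)).
  by apply: (walk k) => //; rewrite /= subn0.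
elim: m => [|m IH] s sm sE; apply: step => //.
  have -> : size s = k by apply/eqP; rewrite eqn_leq size_bseq -subn_eq0 sm.
  rewrite -ans_size take_size tree_next_full //.
  by apply: StopsHere; apply: tree_outdeg_leaf.
have sk : ((size s).+1 <= k)%N by rewrite -subn_gt0 sm.
have [s' s'E] : exists s' : k.-bseq bool, s' = take (size s).+1 ans :> seq bool.
  suff s'k : (size (take (size s).+1 ans) <= k)%N by exists (Bseq s'k).
  by rewrite size_takel // ans_size ltnW.
have size_s' : size s' = (size s).+1.
  by rewrite [bseqval s']s'E size_takel // ans_size ltnW.
rewrite -s'E tree_next_short.
by apply: IH; rewrite size_s' // subnS sm.
Qed.

End QuestionTree.

(** * Linear logical functions and networks *)

Lemma linear_logical_sign_determined (R : realType) (n : nat) (T : finType)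
    (D : set 'cV[R]_n) (f : 'cV[R]_n -> T) :
  (0 < n)%N -> sign_determined f -> linear_logical D f.
Proof.
move=> n0 /(exhaustive_questions n0)[[|q0 qs] [g [qs_gt0 q_neq0 fE g_onto]]] //.
have q_neq0' i : (i <= size qs)%N -> (nth q0 (q0 :: qs) i).1 != 0.
  by move=> ik; apply: q_neq0; rewrite mem_nth.
exists (question_tree q_neq0' g_onto) => x _.
rewrite question_tree_fun -fE; congr g.
by rewrite /answers -{1}(mkseq_nth q0 (q0 :: qs)) -map_comp.
Qed.

Lemma piecewise_affine_hidden (R : realType) (d : nat -> nat) (M : nat)
    (L : forall i : nat, 'cV[R]_(d i) -> 'cV[R]_(d i.+1)) :
  (forall i, (i < M)%N -> affine (L i)) -> piecewise_affine (hidden L M).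
Proof.
elim: M => [_|M IH affL]; first exact: piecewise_affine_id.
apply: piecewise_affine_relu; apply: piecewise_affine_comp.
  exact: affL.
by apply: IH => i iM; apply: affL; apply: ltnW.
Qed.

Theorem proposition2p3 (R : realType) (d : nat -> nat) (M : nat)
    (L : forall i : nat, 'cV[R]_(d i) -> 'cV[R]_(d i.+1))
    (c : {set 'I_(d M.+1)} -> 'I_(d M.+1)) :
  (0 < d 0)%N ->
  (forall i : nat, (i <= M)%N -> affine (L i)) ->
  tie_breaking c ->
  linear_logical [set: 'cV[R]_(d 0)] (network L c).
Proof.
move=> d0 affL _; apply: linear_logical_sign_determined => //.
apply: (@sign_determined_index_max _ _ _ c (L M \o hidden L M)).
apply: piecewise_affine_comp; first exact: affL.
by apply: piecewise_affine_hidden => i iM; apply: affL; apply: ltnW.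
Qed.
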